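(* Let $f$ be a real-valued function with $\lim_{x\to\infty} f(x) = \infty$. Then there exists a set $A \subseteq \mathbb{Z}$ such that $r_A(n) = 1$ for every integer $n \in \mathbb{Z}$, and $A(-x,x) \leq f(x)$ for all sufficiently large $x$.
   Context: For a set $A$ of integers, $r_A(n)$ denotes the number of pairs $(a,a') \in A \times A$ with $a \leq a'$ and $a + a' = n$. For real $y \le x$, $A(y,x)$ denotes the number of elements $a \in A$ with $y \leq a \leq x$; in particular $A(-x,x)$ is the number of $a\in A$ with $|a|\le x$. *)

(* Defs.v *)
From HB Require Import structures.
From mathcomp Require Import all_boot all_order all_algebra.
From mathcomp Require Import all_classical all_reals all_analysis.

Set Implicit Arguments.
Unset Strict Implicit.
Unset Printing Implicit Defensive.

Import Order.TTheory GRing.Theory Num.Theory.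
Import numFieldNormedType.Exports.

Local Open Scope classical_set_scope.
Local Open Scope ring_scope.

(* r_A(n).  The value is an extended real because infinitely many pairs may
   represent n, in which case [counting] returns +oo. *)
Definition repr_count (R : realType) (A : set int) (n : int) : \bar R :=
  counting [set p : int * int |
    [/\ A p.1, A p.2, p.1 <= p.2 & p.1 + p.2 = n]].

(* A(y, x).  The endpoints y and x are real, so the integer a is compared with
   them through its image a%:~R. *)
Definition interval_count (R : realType) (A : set int) (y x : R) : \bar R :=
  counting [set a : int | A a /\ y <= a%:~R <= x].

(* Main.v *)
Require Import Defs.
From HB Require Import structures.
From mathcomp Require Import all_boot all_order all_algebra.
From mathcomp Require Import zify.
From mathcomp Require finmap.
From mathcomp Require Import all_classical all_reals all_analysis.

Import Order.TTheory GRing.Theory Num.Theory.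
Import numFieldNormedType.Exports.

Local Open Scope classical_set_scope.
Local Open Scope ring_scope.

(** Build [A] greedily as an increasing union of finite Sidon sets, running
    through an enumeration of the integers.  If the [k]-th integer [n] is not yet
    a sum, adjoin [-b] and [n + b] with [b] huge: every new sum other than [n]
    lies near [±b] or [±2b], away from the old ones, so the set stays Sidon.
    Since [b] is free, step [k] can be postponed past a threshold [L k] beyond
    which [f >= 2(k+1)], the largest possible size of the set after that step. *)

(** Pairs are ordered, as in [repr_count]; [b = d] then follows from [a = c] by cancellation. *)
Definition sidon (A : set int) := forall a b c d : int,
  A a -> A b -> A c -> A d -> a <= b -> c <= d -> a + b = c + d -> a = c.

Definition is_sum (A : set int) (n : int) :=
  exists a b : int, [/\ A a, A b, a <= b & a + b = n].

Lemma is_sumS (A B : set int) n : A `<=` B -> is_sum A n -> is_sum B n.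
Proof. by move=> AB [a [b [Aa Ab le_ab <-]]]; exists a, b; split=> //; apply: AB. Qed.

(** The condition involves only four elements at a time, and these all lie in one member of the
    increasing chain. *)
Lemma sidon_bigcup (S : nat -> set int) :
  {homo S : i j / (i <= j)%N >-> i `<=` j} -> (forall k, sidon (S k)) ->
  sidon (\bigcup_k S k).
Proof.
move=> S_homo S_sidon a b c d [i _ Sa] [j _ Sb] [k _ Sc] [l _ Sd].
pose m := maxn (maxn i j) (maxn k l).
apply: (S_sidon m); [move: Sa|move: Sb|move: Sc|move: Sd];
  by apply: S_homo; rewrite /m; lia.
Qed.

Lemma sidon_adjoin (s : seq int) (M : nat) (n b : int) :
    {in s, forall a, (`|a| <= M)%N} -> 5%:Z * M%:Z + 5%:Z * `|n|%N%:Z < b ->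
    sidon [set` s] -> ~ is_sum [set` s] n ->
  sidon [set` - b :: n + b :: s].
Proof.
move=> s_le b_gt s_sidon n_notin x y z w /=; rewrite !inE.
move=> /or3P[/eqP->|/eqP->|sx] /or3P[/eqP->|/eqP->|sy]
       /or3P[/eqP->|/eqP->|sz] /or3P[/eqP->|/eqP->|sw];
  try (have := s_le _ sx); try (have := s_le _ sy);
  try (have := s_le _ sz); try (have := s_le _ sw); try lia.
(* Comparing sizes settles all but three cases: in two, one side is [- b + (n + b) = n] and the
   other an old sum; in the third all four elements are old. *)
- move=> wM zM _ le_zw e; exfalso; apply: n_notin; exists z, w; split=> //; lia.
- move=> yM xM le_xy _ e; exfalso; apply: n_notin; exists x, y; split=> //; lia.
- by move=> _ _ _ _; apply: s_sidon.
Qed.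

Lemma sidon_step (s : seq int) (n : int) (L : nat) : sidon [set` s] ->
  exists t : seq int, [/\ (size t <= 2)%N, sidon [set` t ++ s],
    is_sum [set` t ++ s] n & {in t, forall a, (L < `|a|)%N}].
Proof.
move=> s_sidon; have [n_sum|n_nsum] := pselect (is_sum [set` s] n).
  by exists [::].
pose M := (\max_(a <- s) `|a|)%N.
(* The first two terms are the bound in [sidon_adjoin]; adding [L + 1] pushes both [- b] and [n + b]
   past [L] in absolute value. *)
pose b := 5%:Z * M%:Z + 5%:Z * `|n|%N%:Z + L%:Z + 1.
have s_le : {in s, forall a, (`|a| <= M)%N}.
  by move=> a sa; rewrite /M (leq_bigmax_seq a).
exists [:: - b; n + b]; split=> //.
- by apply: sidon_adjoin s_le _ s_sidon n_nsum; rewrite /b; lia.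
- exists (- b), (n + b); rewrite /= !inE !eqxx orbT; split=> //; rewrite /b; lia.
- by move=> a; rewrite !inE => /orP[] /eqP->; rewrite /b; lia.
Qed.

Lemma sidon_chain (L : nat -> nat) : exists S : nat -> seq int,
  [/\ {homo S : i j / (i <= j)%N >-> {subset i <= j}},
      forall k, (size (S k) <= k.*2)%N, forall k, sidon [set` S k],
      forall n, exists k, is_sum [set` S k] n &
      forall k a, a \in S k.+1 -> a \notin S k -> (L k < `|a|)%N].
Proof.
(* With the Sidon condition as a premise, [g] is total, so [S] can be defined before its invariant
   is proved. *)
pose P (x : seq int * int * nat) t := sidon [set` x.1.1] ->
  [/\ (size t <= 2)%N, sidon [set` t ++ x.1.1],
    is_sum [set` t ++ x.1.1] x.1.2 & {in t, forall a, (x.2 < `|a|)%N}].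
have /choice[g gP] : forall x, exists t, P x t.
  move=> [[s n] l]; have [/(sidon_step s n l)[t tP]|] := pselect (sidon [set` s]).
    by exists t.
  by exists [::].
(* Step [pickle n] treats [n]; at a code of no integer the default [0] is treated again,
   harmlessly. *)
pose S := fix S (k : nat) : seq int := if k is k'.+1 then
  g (S k', odflt 0 (unpickle k'), L k') ++ S k' else [::].
have S_sidon k : sidon [set` S k].
  by elim: k => [|k /(gP (S k, odflt 0 (unpickle k), L k))[]] // a b c d.
have SP k := gP (S k, odflt 0 (unpickle k), L k) (S_sidon k).
exists S; split=> //.
- apply: homo_leq => [s a //|s1 s2 s3 s12 s23 a /s12/s23//|k a].
  by rewrite /= mem_cat => ->; rewrite orbT.
- elim=> // k IHk; have [+ _ _ _] := SP k.
  by rewrite /= size_cat => /leq_add/(_ IHk)/leq_trans; apply; lia.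
- move=> n; exists (pickle n).+1.
  by have [_ _ + _] := SP (pickle n); rewrite /= pickleK.
- move=> k a; rewrite /= mem_cat => /orP[ga _|->//].
  by have [_ _ _] := SP k; apply.
Qed.

Lemma counting_le_size (R : realType) (T : choiceType) (X : set T) (s : seq T) :
  X `<=` [set` s] -> (counting X <= (size s)%:R%:E :> \bar R)%E.
Proof.
move=> Xs; have fin_s := finite_seq s.
have fin_X : finite_set X := sub_finite_set Xs fin_s.
rewrite /counting asboolT// lee_fin ler_nat.
apply: uniq_leq_size => [|x]; first exact: finmap.fset_uniq.
by move=> xX; apply: Xs; move: xX; rewrite in_fset_set// inE.
Qed.

Lemma repr_count_sidon (R : realType) (A : set int) (n : int) :
  sidon A -> is_sum A n -> repr_count R A n = 1%E.
Proof.
move=> A_sidon [a [b [Aa Ab le_ab <-]]]; rewrite /repr_count.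
have -> : [set p : int * int |
    [/\ A p.1, A p.2, p.1 <= p.2 & p.1 + p.2 = a + b]] = [set (a, b)].
  apply/seteqP; split=> [[c d] /= [Ac Ad le_cd e]|_ -> //].
  have eca : c = a by apply: A_sidon e.
  by move: e; rewrite eca => /addrI->.
by rewrite /counting asboolT// fset_set1 finmap.cardfs1.
Qed.

Theorem theorem1 (R : realType) (f : R -> R)
  (f_infty : f x @[x --> +oo] --> +oo) :
  exists A : set int,
    (forall n : int, repr_count R A n = 1%E) /\
    (\forall x \near +oo, (interval_count A (- x) x <= (f x)%:E)%E).
Proof.
(* The clause [k <= l] leaves only finitely many thresholds below a given [x], so that a last one
   exists. *)
have /choice[L LP] k : exists l : nat, (k <= l)%N /\
    forall x : R, l%:R <= x -> (k.+1).*2%:R <= f x.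
  have /cvgryPge/(_ (k.+1).*2%:R) [r [_ rP]] := f_infty.
  exists (maxn k (Num.bound `|r|)); split=> [|x le_x]; first exact: leq_maxl.
  apply: rP; apply: le_lt_trans (ler_norm r) _.
  apply: lt_le_trans (archi_boundP (normr_ge0 r)) _.
  by apply: le_trans le_x; rewrite ler_nat leq_maxr.
have [S [S_homo S_size S_sidon S_sum S_new]] := sidon_chain L.
pose A := \bigcup_k [set` S k]; have A_sidon : sidon A.
  by apply: sidon_bigcup => // i j le_ij a; apply: S_homo.
exists A; split=> [n|].
  have [k nk] := S_sum n; apply: repr_count_sidon => //.
  by apply: is_sumS nk => a; exists k.
near=> x.
(* This guarantees that at least one threshold is at most [x]. *)
have L0x : (L 0%N)%:R <= x by near: x; apply: nbhs_pinfty_ge; rewrite num_real.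
have x_ge0 : 0 <= x by apply: le_trans L0x; rewrite ler0n.
(* Steps after k only adjoin elements of absolute value > x. *)
have [k Lkx k_max] : exists2 k, (L k)%:R <= x &
    forall j, (L j)%:R <= x -> (j <= k)%N.
  have exk : exists k, (fun k => (L k)%:R <= x) k by exists 0%N.
  have bnd j : (L j)%:R <= x -> (j <= Num.bound x)%N.
    move=> Ljx; rewrite -(ler_nat R); apply: le_trans (ltW (archi_boundP x_ge0)).
    by apply: le_trans Ljx; rewrite ler_nat; case: (LP j).
  by have [k] := ex_maxnP exk bnd; exists k.
apply: (@le_trans _ _ (size (S k.+1))%:R%:E).
  apply: counting_le_size => a [[i _ /= Sia] /andP[xa ax]].
  have La j : (L j < `|a|)%N -> (j <= k)%N.
    move=> lt_La; apply: k_max; apply: (@le_trans _ _ `|a|%N%:R).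
      by rewrite ler_nat ltnW.
    by rewrite natr_absz intr_norm ler_norml xa.
  (* Going down to the step [i] that adjoined [a] gives [L i < |a| <= x], hence [i <= k]. *)
  elim: i Sia => [|i IHi] Sia.
    exact: S_homo Sia.
  have [/IHi//|aNi] := boolP (a \in S i).
  by apply: S_homo (Sia); rewrite ltnS; apply/La/S_new.
rewrite lee_fin; have [_ /(_ _ Lkx)] := LP k; apply: le_trans.
by rewrite ler_nat.
Unshelve. all: by end_near.
Qed.
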